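(* Let $n=3$ or $n=4$ and let $u\in S_n$. The irreducible characters of $D(S_n)$ induced from the irreducible characters of $C_{S_n}(u)$ are all I-equivalent to each other if and only if $C_{S_n}(u)$ is abelian.
   Context: For a finite group $G$, the Drinfel'd double $D(G)$ is the semisimple Hopf algebra over $\mathbb{C}$ with basis $\{p_g\bowtie x : g,x\in G\}$, multiplication $(p_k\bowtie z)(p_h\bowtie y)=\delta_{k,zhz^{-1}}\,p_k\bowtie zy$, unit $\sum_{g\in G}p_g\bowtie 1$, comultiplication $\Delta(p_g\bowtie x)=\sum_{h\in G}(p_h\bowtie x)\otimes(p_{h^{-1}g}\bowtie x)$, counit $\epsilon(p_g\bowtie x)=\delta_{g,1}$ and antipode $S(p_g\bowtie x)=p_{x^{-1}g^{-1}x}\bowtie x^{-1}$. Put $\Lambda=\frac1{|G|}\sum_{g\in G}p_1\bowtie g$, and for $m\ge1$ let $\Lambda^{[m]}=\sum\Lambda_1\cdots\Lambda_m$ be the $m$-fold product of the iterated comultiplication of $\Lambda$ ($\Lambda^{[1]}=\Lambda$). For an irreducible character $\chi$ of $D(G)$ (trace function of a simple module), $\nu_m(\chi)=\chi(\Lambda^{[m]})$ is its $m$-th Frobenius-Schur indicator. For $u\in G$ and a simple $\mathbb{C}C_G(u)$-module $V$ with character $\eta$, the space $\hat V=\mathbb{C}G\otimes_{\mathbb{C}C_G(u)}V$ is a simple $D(G)$-module via $(p_h\bowtie x)\cdot(y\otimes v)=\delta_{xyu(xy)^{-1},\,h}\;xy\otimes v$ for $h,x,y\in G$, $v\in V$;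 its character is called the character of $D(G)$ induced from $\eta$ (or induced from $C_G(u)$). Two characters $\chi,\chi'$ of $D(G)$ are I-equivalent if $\nu_m(\chi)=\nu_m(\chi')$ for all positive integers $m$. *)

(* Defs.v *)
From HB Require Import structures.
From mathcomp Require Import all_boot all_order all_algebra all_fingroup.
From mathcomp Require Import mxrepresentation.

Set Implicit Arguments.
Unset Strict Implicit.
Unset Printing Implicit Defensive.

Import GRing.Theory.
Local Open Scope ring_scope.

(* The carrier is the space of coefficient functions: [a (g, x)] is the       *)
(* coefficient of p_g |><| x in [a].                                          *)
Definition ddouble (F : fieldType) (gT : finGroupType) := {ffun gT * gT -> F^o}.

HB.instance Definition _ (F : fieldType) (gT : finGroupType) :=
  Vector.on (ddouble F gT).

Section Algebra.
Variables (F : fieldType) (gT : finGroupType).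
Local Notation D := (ddouble F gT).
Implicit Types (a b c : D) (i j k : gT * gT).

Definition dbasis i : D := [ffun j => (j == i)%:R].

Definition dbasis_mul i j : D :=
  if i.1 == (i.2 * j.1 * (i.2)^-1)%g then dbasis (i.1, (i.2 * j.2)%g) else 0.

Definition dmul a b : D := \sum_i \sum_j (a i * b j) *: dbasis_mul i j.

Definition dunit : D := \sum_(g : gT) dbasis (g, 1%g).

Lemma dbasis_sum a : a = \sum_i a i *: dbasis i.
Proof.
apply/ffunP=> j; rewrite sum_ffunE (bigD1 j) //= big1 => [|i ij].
  by rewrite !ffunE eqxx addr0 [RHS]mulr1.
by rewrite !ffunE eq_sym (negPf ij) [LHS]mulr0.
Qed.

Lemma dbasis_ind (P : D -> Prop) :
    P 0 -> (forall a b, P a -> P b -> P (a + b)) ->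
    (forall r i, P (r *: dbasis i)) -> forall a, P a.
Proof. by move=> P0 PD Pb a; rewrite (dbasis_sum a); elim/big_ind: _. Qed.

Fact dmulDl : left_distributive dmul +%R.
Proof.
move=> a b c; rewrite /dmul -big_split; apply: eq_bigr => i _ /=.
by rewrite -big_split; apply: eq_bigr => j _; rewrite ffunE mulrDl scalerDl.
Qed.

Fact dmulDr : right_distributive dmul +%R.
Proof.
move=> a b c; rewrite /dmul -big_split; apply: eq_bigr => i _ /=.
by rewrite -big_split; apply: eq_bigr => j _; rewrite ffunE mulrDr scalerDl.
Qed.

Fact dmulZl r a b : r *: dmul a b = dmul (r *: a) b.
Proof.
rewrite /dmul scaler_sumr; apply: eq_bigr => i _.
by rewrite scaler_sumr; apply: eq_bigr => j _; rewrite ffunE -mulrA scalerA.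
Qed.

Fact dmulZr r a b : r *: dmul a b = dmul a (r *: b).
Proof.
rewrite /dmul scaler_sumr; apply: eq_bigr => i _.
by rewrite scaler_sumr; apply: eq_bigr => j _; rewrite ffunE mulrCA scalerA.
Qed.

Fact dmul0l b : dmul 0 b = 0.
Proof. by have := dmulZl 0 0 b; rewrite !scale0r. Qed.

Fact dmul0r a : dmul a 0 = 0.
Proof. by have := dmulZr 0 a 0; rewrite !scale0r. Qed.

Fact dmul_suml I (r : seq I) (f : I -> D) b :
  dmul (\sum_(i <- r) f i) b = \sum_(i <- r) dmul (f i) b.
Proof.
by elim/big_rec2: _ => [|i x y _ <-]; rewrite ?dmul0l ?dmulDl.
Qed.

Fact dmul_sumr I (r : seq I) (f : I -> D) a :
  dmul a (\sum_(i <- r) f i) = \sum_(i <- r) dmul a (f i).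
Proof.
by elim/big_rec2: _ => [|i x y _ <-]; rewrite ?dmul0r ?dmulDr.
Qed.

Fact dmul_dbasis i j : dmul (dbasis i) (dbasis j) = dbasis_mul i j.
Proof.
rewrite /dmul (bigD1 i) //= (bigD1 j) //= !ffunE !eqxx mulr1 scale1r.
rewrite big1 => [|k kj]; last by rewrite !ffunE (negPf kj) mulr0 scale0r.
rewrite addr0 big1 ?addr0 // => k ki; rewrite big1 // => l _.
by rewrite !ffunE (negPf ki) mul0r scale0r.
Qed.

Fact dbasis_mulA i j k :
  dmul (dbasis i) (dbasis_mul j k) = dmul (dbasis_mul i j) (dbasis k).
Proof.
case: i j k => [g x] [h y] [k z]; rewrite /dbasis_mul /=.
case: (h =P _) => [->|hk]; case: (g =P _) => [->|gh];
  rewrite ?dmul0l ?dmul0r ?dmul_dbasis /dbasis_mul //= ?mulgA.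
- by rewrite invMg !mulgA !eqxx.
- by case: eqP => // E; case: gh; rewrite E !mulgA.
- case: eqP => // E; case: hk; move: E; rewrite invMg !mulgA.
  by move/mulIg; rewrite -!mulgA => /mulgI ->.
Qed.

Fact dmulA : associative dmul.
Proof.
move=> a b c; elim/dbasis_ind: a => [|a a' IHa IHa'|r i].
- by rewrite !dmul0l.
- by rewrite !dmulDl IHa IHa'.
elim/dbasis_ind: b => [|b b' IHb IHb'|s j].
- by rewrite dmul0l !dmul0r dmul0l.
- by rewrite dmulDr !dmulDl dmulDr IHb IHb'.
elim/dbasis_ind: c => [|c c' IHc IHc'|t k]; first by rewrite !dmul0r.
  by rewrite !dmulDr IHc IHc'.
rewrite -!(dmulZl, dmulZr) !dmul_dbasis dbasis_mulA.
by rewrite !scalerA -[t * r * s]mulrA [t * _]mulrC.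
Qed.

Fact dmul1l : left_id dunit dmul.
Proof.
elim/dbasis_ind => [|a b IHa IHb|r [g x]]; first by rewrite dmul0r.
  by rewrite dmulDr IHa IHb.
rewrite -dmulZr dmul_suml (bigD1 g) //= big1 => [|h hg].
  by rewrite dmul_dbasis /dbasis_mul /= invg1 mul1g mulg1 eqxx mul1g addr0.
by rewrite dmul_dbasis /dbasis_mul /= invg1 mul1g mulg1 (negPf hg).
Qed.

Fact dmul1r : right_id dunit dmul.
Proof.
elim/dbasis_ind => [|a b IHa IHb|r [g x]]; first by rewrite dmul0l.
  by rewrite dmulDl IHa IHb.
rewrite -dmulZl dmul_sumr (bigD1 (x^-1 * g * x)%g) //= big1 => [|h hg].
  rewrite dmul_dbasis /dbasis_mul /= !mulgA mulgV mul1g mulgK eqxx.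
  by rewrite mulg1 addr0.
rewrite dmul_dbasis /dbasis_mul /=; case: eqP => // gE.
by case/eqP: hg; rewrite gE !mulgA mulVg mul1g mulgKV.
Qed.

Fact dunit_neq0 : dunit != 0.
Proof.
apply/eqP => /ffunP/(_ (1%g, 1%g)); rewrite sum_ffunE (bigD1 1%g) //= big1.
  by rewrite !ffunE eqxx addr0; apply/eqP; rewrite oner_eq0.
by move=> g g1; rewrite ffunE xpair_eqE eq_sym (negPf g1).
Qed.

HB.instance Definition _ := GRing.Zmodule_isNzRing.Build (ddouble F gT)
  dmulA dmul1l dmul1r dmulDl dmulDr dunit_neq0.
HB.instance Definition _ :=
  GRing.Lmodule_isLalgebra.Build F (ddouble F gT) dmulZl.
HB.instance Definition _ :=
  GRing.Lalgebra_isAlgebra.Build F (ddouble F gT) dmulZr.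

(* The tensor powers of [ddouble F gT] are likewise given by coefficient      *)
(* functions, on pairs or tuples of basis indices.                            *)
Definition dcomul a : {ffun (gT * gT) * (gT * gT) -> F^o} :=
  \sum_i a i *: \sum_(h : gT)
    [ffun p => (p == ((h, i.2), ((h^-1 * i.1)%g, i.2)))%:R].

(* diter_comul m takes values in the (m+1)-st tensor power; the recursion is  *)
(* Delta^(m+1) = (id (x) Delta^(m)) \o Delta, independent of bracketing by    *)
(* coassociativity.                                                           *)
Fixpoint diter_comul m : D -> {ffun m.+1.-tuple (gT * gT) -> F^o} :=
  if m is k.+1 then fun a =>
    [ffun t : k.+2.-tuple (gT * gT) =>
      \sum_j dcomul a (thead t, j) * diter_comul k (dbasis j) (behead_tuple t)]
  else fun a => [ffun t => a (thead t)].

Definition dtensor_mul m (T : {ffun m.-tuple (gT * gT) -> F^o}) : D :=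
  \sum_t T t *: \prod_(i <- t) dbasis i.

Definition dLambda : D := (#|gT|%:R)^-1 *: \sum_(g : gT) dbasis (1%g, g).

(* The m-fold Sweedler power of dLambda; only meaningful for m > 0.           *)
Definition dLambda_pow m : D := dtensor_mul (diter_comul m.-1 dLambda).

Definition FS_indicator m (chi : D -> F) : F := chi (dLambda_pow m).

Definition I_equivalent (chi chi' : D -> F) : Prop :=
  forall m, (0 < m)%N -> FS_indicator m chi = FS_indicator m chi'.

End Algebra.

Section Modules.
Variables (F : fieldType) (gT : finGroupType) (vT : vectType F).
Local Notation D := (ddouble F gT).
Implicit Types (act : D -> vT -> vT).

Record is_dmodule act : Prop := IsDModule {
  dact_linearl : forall v, linear (act^~ v);
  dact_linearr : forall a, linear (act a);
  dact1 : forall v, act 1 v = v;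
  dactM : forall a b v, act (a * b) v = act a (act b v) }.

Definition is_simple_dmodule act : Prop :=
  [/\ is_dmodule act, ({:vT} != 0)%VS &
      forall U : {vspace vT}, (forall a v, v \in U -> act a v \in U) ->
        U = 0%VS \/ U = fullv].

Definition dcharacter act (a : D) : F :=
  \sum_(i < \dim {:vT}) coord (vbasis {:vT}) i (act a (vbasis {:vT})`_i).

End Modules.

Definition irreducible_dcharacter (F : fieldType) (gT : finGroupType)
    (chi : ddouble F gT -> F) : Prop :=
  exists (vT : vectType F) (act : ddouble F gT -> vT -> vT),
    is_simple_dmodule act /\ chi =1 dcharacter act.

Section Induced.
Variables (F : fieldType) (gT : finGroupType) (u : gT) (d : nat).
(* V is the left module of column vectors, where c acts as [mulmx (rV c)].    *)
(* [mx_irreducible] speaks of row subspaces; see [mx_irreducible_col].        *)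
Variable rV : mx_representation F 'C[u] d.
Local Notation D := (ddouble F gT).
Local Notation V := 'cV[F]_d.

(* The group algebra of gT tensored with V over F.                            *)
Local Notation W := {ffun gT -> V}.
Implicit Types (w : W) (v : V) (x y : gT).

Definition tens y v : W := [ffun z => if z == y then v else 0].

Definition balance y c v : W := tens (y * c) v - tens y (rV c *m v).

Definition balance_rel : {vspace W} :=
  (\sum_(y : gT) \sum_(c in 'C[u]%g) limg (linfun (balance y c)))%VS.

(* W modulo balance_rel, i.e. the tensor product over the group algebra of    *)
(* 'C[u], realised on a complement; see [ind_class_eq0] and [ind_act_tens].   *)
Definition ind_mod := subvs_of (balance_rel^C)%VS.

Definition ind_class w : ind_mod :=
  vsproj (balance_rel^C)%VS (daddv_pi (balance_rel^C)%VS balance_rel w).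

HB.instance Definition _ := Vector.on ind_mod.

(* The action of p_h |><| x on y (x) v, for i = (h, x).                       *)
Definition act_tens (i : gT * gT) y v : W :=
  if (i.2 * y * u * (i.2 * y)^-1)%g == i.1 then tens (i.2 * y) v else 0.

Definition act_free (a : D) w : W :=
  \sum_i a i *: \sum_(y : gT) act_tens i y (w y).

Definition ind_act (a : D) (q : ind_mod) : ind_mod :=
  ind_class (act_free a (vsval q)).

Fact tens_linear y : linear (tens y).
Proof.
move=> r v v'; apply/ffunP=> z; rewrite !ffunE.
by case: eqP; rewrite ?scaler0 ?addr0.
Qed.
HB.instance Definition _ y :=
  GRing.isLinear.Build F V W _ (tens y) (tens_linear y).

Fact balance_linear y c : linear (balance y c).
Proof.
move=> r v v'; rewrite /balance mulmxDr -scalemxAr !tens_linear.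
by rewrite scalerBr opprD addrACA.
Qed.
HB.instance Definition _ y c :=
  GRing.isLinear.Build F V W _ (balance y c) (balance_linear y c).

Fact ind_class_linear : linear ind_class.
Proof. by move=> r w w'; rewrite /ind_class !linearP. Qed.
HB.instance Definition _ :=
  GRing.isLinear.Build F W ind_mod _ ind_class ind_class_linear.

Fact act_tens_linear i y : linear (act_tens i y).
Proof.
move=> r v v'; rewrite /act_tens; case: ifP => _; rewrite ?tens_linear //.
by rewrite scaler0 addr0.
Qed.
HB.instance Definition _ i y :=
  GRing.isLinear.Build F V W _ (act_tens i y) (act_tens_linear i y).

Fact act_free_linear a : linear (act_free a).
Proof.
move=> r w w'; rewrite /act_free scaler_sumr -big_split; apply: eq_bigr => i _.
rewrite /= scalerA [r * _]mulrC -scalerA -scalerDr; congr (_ *: _).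
rewrite scaler_sumr -big_split; apply: eq_bigr => y _.
by rewrite !ffunE act_tens_linear.
Qed.
HB.instance Definition _ a :=
  GRing.isLinear.Build F W W _ (act_free a) (act_free_linear a).

Fact act_free_linearl w : linear (act_free^~ w).
Proof.
move=> r a b; rewrite /act_free scaler_sumr -big_split; apply: eq_bigr => i _.
by rewrite /= scalerA -scalerDl !ffunE.
Qed.

Lemma ind_class_eq0 w : (ind_class w == 0) = (w \in balance_rel).
Proof.
have dU : (balance_rel :&: balance_rel^C = 0)%VS by apply: capv_compl.
have dU' : (balance_rel^C :&: balance_rel = 0)%VS by rewrite capvC.
have wE : daddv_pi (balance_rel^C)%VS balance_rel w
   + daddv_pi balance_rel (balance_rel^C)%VS w = w.
  by apply: daddv_pi_add; rewrite // addvC addv_complf memvf.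
apply/eqP/idP => [w0 | Uw].
  rewrite -wE -[X in X + _](@vsprojK _ _ (balance_rel^C)%VS) ?memv_pi //.
  by rewrite [vsproj _ _]w0 /= add0r memv_pi.
move: wE; rewrite (daddv_pi_id dU Uw) => /(canRL (addrK _)).
by rewrite subrr /ind_class => ->; rewrite linear0.
Qed.

Lemma ind_class_onto (q : ind_mod) : ind_class (vsval q) = q.
Proof.
rewrite /ind_class daddv_pi_id ?subvsP ?vsvalK //.
by rewrite capvC capv_compl.
Qed.

Lemma tens_sum w : w = \sum_y tens y (w y).
Proof.
apply/ffunP=> z; rewrite sum_ffunE (bigD1 z) //= big1 => [|y yz].
  by rewrite ffunE eqxx addr0.
by rewrite ffunE eq_sym (negPf yz).
Qed.

Lemma memv_balance y c v : c \in 'C[u]%g -> balance y c v \in balance_rel.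
Proof.
move=> Cc; rewrite /balance_rel.
apply: (subvP (sumv_sup y (erefl _) (sumv_sup c Cc (subvv _)))).
by rewrite -[balance y c v](lfunE (balance y c)) memv_img ?memvf.
Qed.

Lemma ind_class_tensM y c v : c \in 'C[u]%g ->
  ind_class (tens (y * c) v) = ind_class (tens y (rV c *m v)).
Proof.
move=> Cc; apply/eqP; rewrite -subr_eq0 -linearB ind_class_eq0.
exact: memv_balance.
Qed.

Lemma act_free_tens i y v : act_free (dbasis F i) (tens y v) = act_tens i y v.
Proof.
rewrite /act_free (bigD1 i) //= [X in _ + X]big1 => [|j ji].
  rewrite ffunE eqxx scale1r addr0 (bigD1 y) //= big1 => [|z zy].
    by rewrite ffunE eqxx addr0.
  by rewrite ffunE (negPf zy) linear0.
by rewrite ffunE (negPf ji) scale0r.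
Qed.

Lemma act_tens_balance i y c v : c \in 'C[u]%g ->
  act_tens i (y * c) v - act_tens i y (rV c *m v) \in balance_rel.
Proof.
move=> Cc; rewrite /act_tens mulgA.
have -> : (i.2 * y * c * u * (i.2 * y * c)^-1 = i.2 * y * u * (i.2 * y)^-1)%g.
  rewrite invMg -!mulgA; congr (_ * (_ * _))%g.
  by rewrite !mulgA (cent1P Cc) mulgK.
by case: ifP => _; rewrite ?subrr ?mem0v // memv_balance.
Qed.

Lemma act_free_dbasis i w :
  act_free (dbasis F i) w = \sum_y act_tens i y (w y).
Proof.
rewrite /act_free (bigD1 i) //= [X in _ + X]big1 => [|j ji].
  by rewrite ffunE eqxx scale1r addr0.
by rewrite ffunE (negPf ji) scale0r.
Qed.

Lemma act_freeE a w : act_free a w = \sum_i a i *: act_free (dbasis F i) w.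
Proof. by apply: eq_bigr => i _; rewrite act_free_dbasis. Qed.

Lemma act_free_stable a w : w \in balance_rel -> act_free a w \in balance_rel.
Proof.
move=> Uw.
suff /subvP/(_ w Uw): (balance_rel <= linfun (act_free a) @^-1: balance_rel)%VS.
  by rewrite -memv_preim lfunE.
apply/subv_sumP=> y _; apply/subv_sumP=> c Cc.
apply/subvP=> _ /memv_imgP[v _ ->]; rewrite -memv_preim !lfunE /= act_freeE.
apply: memv_suml => i _; apply: memvZ.
rewrite [act_free _ _](linearB (act_free (dbasis F i))) /= !act_free_tens.
exact: act_tens_balance.
Qed.

Lemma ind_act_class a w : ind_act a (ind_class w) = ind_class (act_free a w).
Proof.
apply/eqP; rewrite -subr_eq0 -linearB -linearB ind_class_eq0 act_free_stable //.
by rewrite -ind_class_eq0 linearB /= ind_class_onto subrr.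
Qed.

Lemma ind_act_tens i y v :
  ind_act (dbasis F i) (ind_class (tens y v)) = ind_class (act_tens i y v).
Proof. by rewrite ind_act_class act_free_tens. Qed.

Lemma act_free1 w : act_free 1 w = w.
Proof.
have EL := act_free_linearl.
pose L w := HB.pack_for {linear D -> W} (act_free^~ w)
  (GRing.isLinear.Build F D W _ (act_free^~ w) (EL w)).
rewrite {2}[w]tens_sum -[LHS]/(L w (\sum_g dbasis F (g, 1%g))) linear_sum /=.
under eq_bigr do rewrite act_free_dbasis.
rewrite exchange_big; apply: eq_bigr => y _ /=.
rewrite (bigD1 (y * u * y^-1)%g) //= big1 => [|g gy].
  by rewrite /act_tens /= !mul1g eqxx addr0.
by rewrite /act_tens /= !mul1g eq_sym (negPf gy).
Qed.

Lemma act_tensM i j y v :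
  act_free (dbasis_mul F i j) (tens y v) = act_free (dbasis F i) (act_tens j y v).
Proof.
case: i j => [g x] [h z]; rewrite /dbasis_mul [act_tens (h, z) y v]/act_tens /=.
have [<-|zh] := eqVneq (z * y * u * (z * y)^-1)%g h.
  rewrite act_free_tens [act_tens (g, x) _ _]/act_tens /= !invMg !mulgA [_ == g]eq_sym.
  case: ifP => [gE|_]; last first.
    by rewrite /act_free big1 // => i _; rewrite ffunE scale0r.
  by rewrite act_free_tens /act_tens /= !invMg !mulgA [_ == g]eq_sym gE.
rewrite linear0; case: eqP => [gE|_]; last first.
  by rewrite /act_free big1 // => i _; rewrite ffunE scale0r.
rewrite act_free_tens /act_tens /=; case: eqP => // E; case/eqP: zh.
move: E; rewrite gE !invMg !mulgA => /mulIg; rewrite -!mulgA => /mulgI.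
by [].
Qed.

Lemma act_freeM a b w : act_free (a * b) w = act_free a (act_free b w).
Proof.
have EL := act_free_linearl.
pose L w := HB.pack_for {linear D -> W} (act_free^~ w)
  (GRing.isLinear.Build F D W _ (act_free^~ w) (EL w)).
have L0 w' : act_free 0 w' = 0 := linear0 (L w').
have LD a1 a2 w' : act_free (a1 + a2) w' = act_free a1 w' + act_free a2 w'
  := linearD (L w') a1 a2.
have LZ r a1 w' : act_free (r *: a1) w' = r *: act_free a1 w'
  := linearZ_LR (L w') r a1.
elim/dbasis_ind: a => [|a a' IHa IHa'|r i].
- by rewrite mul0r !L0.
- by rewrite mulrDl !LD IHa IHa'.
elim/dbasis_ind: b => [|b b' IHb IHb'|s j].
- by rewrite mulr0 !L0 linear0.
- by rewrite mulrDr !LD linearD IHb IHb'.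
rewrite -scalerAl -scalerAr !LZ.
rewrite [act_free _ (s *: _)](linearZ_LR (act_free (dbasis F i))) /=.
congr (_ *: (_ *: _)).
have LS e (f : gT -> W) : act_free e (\sum_y f y) = \sum_y act_free e (f y).
  exact: linear_sum.
rewrite [dbasis F i * _]dmul_dbasis [w]tens_sum !LS.
by apply: eq_bigr => y _; rewrite act_free_tens act_tensM.
Qed.

Lemma ind_act_dmodule : is_dmodule ind_act.
Proof.
split=> [q r a b|a r q q'|q|a b q].
- by rewrite /ind_act act_free_linearl linearP.
- by rewrite /ind_act !linearP.
- by rewrite /ind_act act_free1 ind_class_onto.
- by rewrite {1}/ind_act act_freeM -ind_act_class.
Qed.

Lemma mx_irreducible_col (X : {vspace V}) : mx_irreducible rV ->
  (forall c v, c \in 'C[u]%g -> v \in X -> rV c *m v \in X) ->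
  X = 0%VS \/ X = fullv.
Proof.
move=> [_ _ irrV] stX.
pose A := \matrix_(i < d, j < \dim X) (vbasis X)`_j i 0.
have AE m (M : 'M_(m, d)) i j : (M *m A) i j = (M *m (vbasis X)`_j) i 0.
  by rewrite !mxE; apply: eq_bigr => k _; rewrite mxE.
have AX (y : 'cV_(\dim X)) : A *m y \in X.
  have -> : A *m y = \sum_j y j 0 *: (vbasis X)`_j.
    apply/colP=> i; rewrite summxE !mxE; apply: eq_bigr => j _.
    by rewrite !mxE mulrC.
  by apply: memv_suml => j _; rewrite memvZ // vbasis_mem // mem_nth ?size_tuple.
have XA v : v \in X -> exists y : 'cV_(\dim X), v = A *m y.
  move=> Xv; exists (\col_j coord (vbasis X) j v).
  apply/colP=> i; rewrite {1}(coord_vbasis Xv) summxE !mxE.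
  by apply: eq_bigr => j _; rewrite !mxE mulrC.
have Kmod : mxmodule rV (kermx A).
  apply/mxmoduleP=> c Cc; apply/sub_kermxP/matrixP=> i j; rewrite AE -mulmxA.
  have /XA[y ->] : rV c *m (vbasis X)`_j \in X.
    by apply: stX; rewrite ?vbasis_mem // mem_nth ?size_tuple.
  by rewrite mulmxA mulmx_ker mul0mx !mxE.
have [K0|K0] := eqVneq (kermx A) 0; last first.
  left; have := irrV _ Kmod (submx1 _) K0; move/sub_kermxP; rewrite mul1mx => A0.
  apply/eqP; rewrite -subv0; apply/subvP=> v /XA[y ->].
  by rewrite A0 mul0mx mem0v.
right; apply/eqP; rewrite eqEsubv subvf; apply/subvP=> v _.
have /row_fullP[B BA] : row_full A^T.
  by rewrite /row_full mxrank_tr -/(row_free A) -kermx_eq0 K0.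
suff -> : v = A *m (B^T *m v) by apply: AX.
by rewrite mulmxA -[A]trmxK -trmx_mul BA trmx1 mul1mx.
Qed.

Lemma balance_rel_tens1 v : tens 1%g v \in balance_rel -> v = 0.
Proof.
pose f w : V := \sum_(c in 'C[u]%g) rV c *m w c.
have fP : linear f.
  move=> r w w'; rewrite /f scaler_sumr -big_split; apply: eq_bigr => c _ /=.
  by rewrite !ffunE mulmxDr scalemxAr.
pose fL := HB.pack_for {linear W -> V} f (GRing.isLinear.Build F W V _ f fP).
have ftens y v' : f (tens y v') = if y \in 'C[u]%g then rV y *m v' else 0.
  rewrite /f; case: ifP => Cy.
    rewrite (bigD1 y) //= big1 ?ffunE ?eqxx ?addr0 // => c /andP[_ cy].
    by rewrite ffunE (negPf cy) mulmx0.
  rewrite big1 // => c Cc; rewrite ffunE; case: eqP => [cy|_]; last exact: mulmx0.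
  by rewrite -cy Cc in Cy.
move=> Uv; have: tens 1%g v \in lker (linfun fL).
  apply: subvP Uv; apply/subv_sumP=> y _; apply/subv_sumP=> c Cc.
  apply/subvP=> _ /memv_imgP[v' _ ->]; rewrite memv_ker !lfunE /=.
  rewrite [f _](linearB fL) /= !ftens groupMr //.
  by case: ifP => [Cy|_]; rewrite ?subrr // repr_mxM // mulmxA subrr.
by rewrite memv_ker lfunE /= ftens group1 repr_mx1 mul1mx => /eqP.
Qed.

Lemma ind_act_simple : mx_irreducible rV -> is_simple_dmodule ind_act.
Proof.
move=> irrV; split; first exact: ind_act_dmodule.
  have [_ /eqP n0 _] := irrV; apply/eqP=> z0; apply: n0; apply/matrixP=> i j.
  have /balance_rel_tens1/colP/(_ i): tens 1%g (col j 1%:M) \in balance_rel.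
    rewrite -ind_class_eq0; have := memvf (ind_class (tens 1%g (col j 1%:M))).
    by rewrite z0 memv0.
  by rewrite !mxE.
move=> U stU.
have U1 y v : ind_class (tens y v) \in U -> ind_class (tens 1%g v) \in U.
  move=> /(stU (dbasis F (u, y^-1%g))); rewrite ind_act_tens /act_tens /=.
  by rewrite mulVg mul1g invg1 mulg1 eqxx.
have Uy y v : ind_class (tens 1%g v) \in U -> ind_class (tens y v) \in U.
  move=> /(stU (dbasis F (y * u * y^-1, y)%g)); rewrite ind_act_tens /act_tens /=.
  by rewrite mulg1 eqxx.
pose X := (linfun (ind_class \o tens 1%g) @^-1: U)%VS.
have XE v : (v \in X) = (ind_class (tens 1%g v) \in U).
  by rewrite -memv_preim lfunE.
have [c v Cc|X0|X1] := mx_irreducible_col (X := X) irrV.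
- by rewrite !XE => Uv; rewrite -ind_class_tensM // mul1g Uy.
- left; apply/eqP; rewrite -subv0; apply/subvP=> q Uq; rewrite memv0.
  have qE : q = \sum_h ind_act (dbasis F (h, 1%g)) q.
    under eq_bigr do rewrite /ind_act act_free_dbasis.
    rewrite -linear_sum exchange_big /= -{1}[q]ind_class_onto; congr ind_class.
    rewrite {1}[vsval q]tens_sum; apply: eq_bigr => y _.
    rewrite (bigD1 (y * u * y^-1)%g) //= big1 => [|g gy].
      by rewrite /act_tens /= !mul1g eqxx addr0.
    by rewrite /act_tens /= !mul1g eq_sym (negPf gy).
  rewrite qE big1 // => h _; have := stU (dbasis F (h, 1%g)) q Uq.
  rewrite /ind_act act_free_dbasis !linear_sum /=.
  have [/existsP[y /eqP hy]|nh] := boolP [exists y, (y * u * y^-1)%g == h]; last first.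
    move=> _; rewrite big1 // => y _; rewrite /act_tens /= !mul1g.
    by case: ifP => [hy|_]; rewrite ?linear0 //; case/existsP: nh; exists y.
  set w : W := vsval q.
  have -> : \sum_z ind_class (act_tens (h, 1%g) z (w z)) =
            ind_class (tens y (\sum_z if (y^-1 * z)%g \in 'C[u]%g
                               then rV (y^-1 * z)%g *m w z else 0)).
    rewrite !linear_sum /=; apply: eq_bigr => z _; rewrite /act_tens /= !mul1g -hy.
    have <- : ((y^-1 * z)%g \in 'C[u]%g) = (z * u * z^-1 == y * u * y^-1)%g.
      apply/cent1P/eqP => [E | E].
        by apply: (mulIg z); rewrite mulgKV -2!mulgA -E !mulgA mulgV mul1g.
      apply: (mulgI y); rewrite !mulgA mulgV mul1g -[z in RHS]mulg1.
      by move/(congr1 (mulg^~ z)): E; rewrite mulg1 mulgKV => ->.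
    case: ifP => Cz; last by rewrite !linear0.
    by rewrite -ind_class_tensM // mulgA mulgV mul1g.
  by move=> /U1; rewrite -XE X0 memv0 => /eqP->; rewrite !linear0.
- right; apply/eqP; rewrite eqEsubv subvf; apply/subvP=> q _.
  rewrite -[q]ind_class_onto [vsval q]tens_sum linear_sum /=.
  by apply: memv_suml => y _; apply: Uy; rewrite -XE X1 memvf.
Qed.
End Induced.

Arguments ind_act {F gT u d} rV a q.

Definition induced_dcharacter (F : fieldType) (gT : finGroupType) (u : gT)
    (chi : ddouble F gT -> F) : Prop :=
  exists (d : nat) (rV : mx_representation F 'C[u] d),
    mx_irreducible rV /\ chi =1 dcharacter (ind_act rV).

Lemma induced_dcharacter_irreducible (F : fieldType) (gT : finGroupType)
    (u : gT) (chi : ddouble F gT -> F) :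
  induced_dcharacter u chi -> irreducible_dcharacter chi.
Proof.
move=> [d [rV [irrV chiE]]]; exists (ind_mod rV), (ind_act rV).
by split=> //; apply: ind_act_simple.
Qed.

(* Main.v *)
Require Import Defs.
From HB Require Import structures.
From mathcomp Require Import all_boot all_order all_algebra all_fingroup.
From mathcomp Require Import cyclic pgroup mxrepresentation spectral.
From mathcomp Require Import complex reals.

(** Write C for the centralizer of u in G, and let eta be the character of an
    irreducible representation of C. Everything rests on the closed formula
    ([FS_indicator_ind])
<<
      nu_m = 1/|C| * \sum_(g | g^m \in C, (u g^-1)^m g^m = 1) eta (g^m)
>>
    for the m-th indicator of the character of D(G) induced from eta. It has
    two ingredients: the m-th Sweedler power of the integral is the sum of the
    p_h |><| x^m with (h x^-1)^m x^m = 1, divided by |G| ([dLambda_powE]), and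
    the induced character takes on p_h |><| x a value given by the usual
    formula for induced characters, restricted to the y with y u y^-1 = h
    ([dcharacter_ind_dbasis]).

    If all the induced characters are I-equivalent, take m = |G|: every g
    satisfies g^m = 1, so the indicator is |G|/|C| times the degree of eta.
    Hence all irreducible representations of C have the same degree, which is
    the degree 1 of the trivial one, and C is abelian.

    If C is abelian then every eta is linear, and by the formula it suffices
    that (u g^-1)^m g^m = 1 implies g^m = 1: then nu_m is the same number of
    elements g divided by |C| whatever eta is. This implication
    ([common_power_trivial]) is where S_3 and S_4 enter: in these groups an
    element u with an abelian centralizer is odd or a 3-cycle. Put h = u g^-1,
    so that h^m = g^-m; this power commutes with g and h, hence with u. If u is
    odd, exactly one of g and h is odd, so m is even by comparison of signs;
    the m-th power of the even one then has order 1 or 3, the m-th power of the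
    odd one has order a power of 2, and both are trivial. If u is a 3-cycle
    and g^m <> 1, then g^m generates C = <u>, so g and h commute with u, lie in
    C and satisfy u^m = h^m g^m = 1; thus 3 divides m and g^m = 1 after all.
    The groups being so small, the implication is verified below by running
    through all pairs (h, g). *)

Set Implicit Arguments.
Unset Strict Implicit.
Unset Printing Implicit Defensive.

Import GRing.Theory Num.Theory.
Local Open Scope ring_scope.

(** * Sweedler powers of the integral *)

Lemma expg_mulC (gT : finGroupType) (a b : gT) n :
  ((a * b) ^+ n * a = a * (b * a) ^+ n)%g.
Proof.
elim: n => [|n IHn]; first by rewrite mul1g mulg1.
by rewrite expgS -mulgA IHn expgS !mulgA.
Qed.

Section SweedlerPowers.
Variables (F : fieldType) (gT : finGroupType).
Local Notation D := (ddouble F gT).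

(** Multiplying out the factors of an iterated coproduct commutes with splitting
    off its first factor, so Sweedler powers can be computed by recursion. *)
Lemma dtensor_mul_comul k (a : D) :
  dtensor_mul (diter_comul k.+1 a) = \sum_i a i *: \sum_h
    dbasis F (h, i.2) *
      dtensor_mul (diter_comul k (dbasis F ((h^-1 * i.1)%g, i.2))).
Proof.
pose T (j : gT * gT) : D := dtensor_mul (diter_comul k (dbasis F j)).
transitivity (\sum_p dcomul a (p.1, p.2) *: (dbasis F p.1 * T p.2)).
  rewrite -(pair_bigA _ (fun x j => dcomul a (x, j) *: (dbasis F x * T j))) /=.
  pose cons2 (p : (gT * gT) * k.+1.-tuple (gT * gT)) := [tuple of p.1 :: p.2].
  pose cut (t : k.+2.-tuple (gT * gT)) := (thead t, behead_tuple t).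
  have consK : cancel cons2 cut.
    by case=> x t; congr (_, _); apply: val_inj.
  have cutK : cancel cut cons2.
    by move=> t; rewrite [RHS]tuple_eta; apply: val_inj.
  rewrite /dtensor_mul (reindex cons2) /=; last by exists cut => ? _.
  pose G x (t : k.+1.-tuple (gT * gT)) : D :=
    diter_comul k.+1 a [tuple of x :: t] *: \prod_(i <- x :: t) dbasis F i.
  rewrite -(pair_bigA _ G) /=.
  apply: eq_bigr => x _.
  transitivity (\sum_(t : k.+1.-tuple (gT * gT)) \sum_j (dcomul a (x, j) *
      diter_comul k (dbasis F j) t) *:
      (dbasis F x * \prod_(i <- t) dbasis F i)).
    apply: eq_bigr => t _; rewrite /G ffunE big_cons theadE scaler_suml.
    apply: eq_bigr => j _; congr (_ * (diter_comul k _ _) *: _).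
    exact: val_inj.
  rewrite exchange_big; apply: eq_bigr => j _ /=.
  rewrite /T /dtensor_mul mulr_sumr scaler_sumr; apply: eq_bigr => t _.
  by rewrite -scalerA -scalerAr.
under eq_bigr do rewrite -surjective_pairing /dcomul.
under eq_bigr do rewrite sum_ffunE scaler_suml.
rewrite exchange_big; apply: eq_bigr => i _ /=.
under eq_bigr do rewrite ffunE sum_ffunE -[_ *: (_ : F^o)]/(_ * _) -scalerA
  scaler_suml.
rewrite -scaler_sumr exchange_big; congr (_ *: _); apply: eq_bigr => h _ /=.
rewrite (bigD1 ((h, i.2), ((h^-1 * i.1)%g, i.2))) //= ffunE eqxx scale1r.
by rewrite big1 ?addr0 // => p /negPf pE; rewrite ffunE pE scale0r.
Qed.

Lemma dbasisM (g x h y : gT) :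
  dbasis F (g, x) * dbasis F (h, y) =
  if g == (x * h * x^-1)%g then dbasis F (g, (x * y)%g) else 0 :> D.
Proof. exact: dmul_dbasis. Qed.

Lemma dtensor_mul_comul0 (a : D) : dtensor_mul (diter_comul 0 a) = a.
Proof.
rewrite /dtensor_mul [RHS]dbasis_sum (reindex (fun i => [tuple i])) /=.
  by apply: eq_bigr => i _; rewrite ffunE theadE big_seq1.
exists (@thead _ _) => [i _|t _]; first by rewrite theadE.
by case/tupleP: t => i t; rewrite [t]tuple0; apply: val_inj.
Qed.

Lemma dtensor_mul_sum k (a : D) :
  dtensor_mul (diter_comul k a) =
  \sum_i a i *: dtensor_mul (diter_comul k (dbasis F i)).
Proof.
case: k => [|k]; first by under eq_bigr do rewrite dtensor_mul_comul0;
  rewrite dtensor_mul_comul0 -dbasis_sum.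
rewrite dtensor_mul_comul; apply: eq_bigr => i _; congr (_ *: _).
rewrite dtensor_mul_comul (bigD1 i) //= ffunE eqxx scale1r.
rewrite [X in _ = _ + X]big1 ?addr0 // => j ji.
by rewrite ffunE (negPf ji) scale0r.
Qed.

(** The coproduct splits g into products h_1 ... h_m of m = k.+1 factors, and
    the product of the p_(h_j) |><| x survives only when each h_j is the
    conjugate of h_1 = h by x^(1-j). The product of these conjugates, which
    must equal g, telescopes to (h x^-1)^m x^m. *)
Lemma dtensor_mul_dbasis k (g x : gT) :
  dtensor_mul (diter_comul k (dbasis F (g, x))) =
  \sum_(h | ((h * x^-1) ^+ k.+1 * x ^+ k.+1)%g == g)
    dbasis F (h, (x ^+ k.+1)%g).
Proof.
elim: k g => [|k IHk] g.
  rewrite expg1 (big_pred1 g) => [|h]; last by rewrite expg1 mulgKV.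
  exact: dtensor_mul_comul0.
rewrite dtensor_mul_comul (bigD1 (g, x)) //= ffunE eqxx scale1r.
rewrite [X in _ + X]big1 => [|i ig]; last by rewrite ffunE (negPf ig) scale0r.
rewrite addr0 [RHS]big_mkcond /=; apply: eq_bigr => h _.
rewrite IHk mulr_sumr.
have hE h' : (h == x * h' * x^-1)%g = (h' == x^-1 * h * x)%g.
  apply/eqP/eqP => ->; first by rewrite !mulgA mulVg mul1g mulgKV.
  by rewrite !mulgA mulgV mul1g mulgK.
under eq_bigr do rewrite dbasisM hE -expgS.
(* The factor h of the first position leaves only the conjugate x^-1 h x of h
   for the remaining ones. *)
rewrite -big_mkcondr (eq_bigl (fun h' => (h' == x^-1 * h * x)%g &&
    ((h * x^-1) ^+ k.+2 * x ^+ k.+2 == g)%g)) /=; last first.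
  move=> h' /=; rewrite andbC; apply: andb_id2l => /eqP->; rewrite mulgK.
  rewrite -(inj_eq (mulgI h)) mulKVg mulgA -expg_mulC [in RHS]expgSr.
  by rewrite [(x ^+ k.+2)%g]expgS !mulgA mulgKV.
case: ifP => _; last by rewrite big1 // => h'; rewrite andbF.
by rewrite (big_pred1 (x^-1 * h * x)%g) // => h' /=; rewrite andbT.
Qed.

Lemma dLambda_powE m : (0 < m)%N ->
  dLambda_pow F gT m = #|gT|%:R^-1 *: \sum_x
    \sum_(h | ((h * x^-1) ^+ m * x ^+ m)%g == 1%g) dbasis F (h, (x ^+ m)%g).
Proof.
case: m => // k _; rewrite /dLambda_pow /=.
under [in RHS]eq_bigr do rewrite -dtensor_mul_dbasis.
pose G g x : D :=
  dLambda F gT (g, x) *: dtensor_mul (diter_comul k (dbasis F (g, x))).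
rewrite dtensor_mul_sum; transitivity (\sum_p G p.1 p.2).
  by apply: eq_bigr => -[].
rewrite -(pair_bigA _ G) /= (bigD1 1%g) //= [X in _ + X]big1 => [|g g1].
  rewrite addr0 scaler_sumr; apply: eq_bigr => x _; rewrite /G; congr (_ *: _).
  rewrite ffunE sum_ffunE (bigD1 x) //= ffunE eqxx big1 => [|y yx].
    by rewrite addr0 [LHS]mulr1.
  by rewrite ffunE xpair_eqE eqxx eq_sym (negPf yx).
rewrite big1 // => x _; rewrite /G ffunE sum_ffunE big1 => [|y _].
  by rewrite scaler0 scale0r.
by rewrite ffunE xpair_eqE (negPf g1).
Qed.

End SweedlerPowers.

(** * Characters of induced modules *)

(** The trace is cyclic: if the action of [a] factors through another space
    [wT], its trace can be taken there, where any basis [w] with coordinate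
    functions [phi] will do. *)
Lemma dcharacter_factor (F : fieldType) (gT : finGroupType)
    (vT wT : vectType F) (I : finType) (act : ddouble F gT -> vT -> vT) a
    (w : I -> wT) (phi : I -> {linear wT -> F^o})
    (g : {linear wT -> vT}) (h : {linear vT -> wT}) :
    (forall x, x = \sum_k phi k x *: w k) -> act a =1 g \o h ->
  dcharacter act a = \sum_k phi k (h (g (w k))).
Proof.
move=> phiP actE; rewrite /dcharacter; set e := vbasis _.
transitivity
  (\sum_(i < \dim {:vT}) \sum_k phi k (h e`_i) * coord e i (g (w k))).
  apply: eq_bigr => i _; rewrite actE /= {1}[h _]phiP !linear_sum /=.
  by apply: eq_bigr => k _; rewrite !linearZ.
rewrite exchange_big; apply: eq_bigr => k _ /=.
rewrite {2}(coord_vbasis (memvf (g (w k)))) !linear_sum /=.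
by apply: eq_bigr => i _; rewrite !linearZ /= mulrC.
Qed.

Section InducedCharacter.
Variables (F : fieldType) (gT : finGroupType) (u : gT) (d : nat).
Variable rV : mx_representation F 'C[u] d.
Local Notation D := (ddouble F gT).
Local Notation V := 'cV[F]_d.
Local Notation W := {ffun gT -> V}.
Hypothesis nzC : #|'C[u]%g|%:R != 0 :> F.

(** Averaging over 'C[u] is an idempotent of the free module whose kernel is
    [balance_rel] and which is the identity modulo it. It allows traces on the
    tensor product over the group algebra of 'C[u] to be computed on the free
    module, which has an explicit basis. *)
Definition avg (w : W) : W :=
  #|'C[u]%g|%:R^-1 *:
    \sum_y \sum_(c in 'C[u]%g) tens (y * c^-1)%g (rV c *m w y).

Fact avg_linear : linear avg.
Proof.
move=> r w w'; rewrite /avg scalerA mulrC -scalerA -scalerDr; congr (_ *: _).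
rewrite scaler_sumr -big_split; apply: eq_bigr => y _ /=.
rewrite scaler_sumr -big_split; apply: eq_bigr => c _ /=.
by rewrite !ffunE mulmxDr -scalemxAr linearP.
Qed.
HB.instance Definition _ := GRing.isLinear.Build F W W _ avg avg_linear.

Lemma avg_tens y v :
  avg (tens y v) =
  #|'C[u]%g|%:R^-1 *: \sum_(c in 'C[u]%g) tens (y * c^-1)%g (rV c *m v).
Proof.
rewrite /avg (bigD1 y) //= [X in _ + X]big1 ?addr0 => [|z zy].
  by congr (_ *: _); apply: eq_bigr => c _; rewrite ffunE eqxx.
by rewrite big1 // => c _; rewrite ffunE (negPf zy) mulmx0 linear0.
Qed.

Lemma avg_balance_rel w : w \in balance_rel rV -> avg w = 0.
Proof.
move=> Uw; suff /subvP/(_ w Uw): (balance_rel rV <= lker (linfun avg))%VS.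
  by rewrite memv_ker lfunE => /eqP.
apply/subv_sumP=> y _; apply/subv_sumP=> c Cc.
apply/subvP=> _ /memv_imgP[v _ ->]; rewrite memv_ker !lfunE /= linearB.
rewrite /= !avg_tens subr_eq0; apply/eqP; congr (_ *: _).
rewrite (reindex_inj (mulIg c)); apply: eq_big => [b|b].
  exact: groupMr.
by rewrite groupMr // => Cb; rewrite invMg mulgA mulgK repr_mxM // mulmxA.
Qed.

Lemma ind_class_avg w : ind_class rV (avg w) = ind_class rV w.
Proof.
rewrite {2}[w]tens_sum /avg linearZ !linear_sum /= scaler_sumr.
apply: eq_bigr => y _; rewrite linear_sum /=.
rewrite (eq_bigr (fun=> ind_class rV (tens y (w y)))) => [|c Cc].
  by rewrite sumr_const -scaler_nat scalerA mulVf ?scale1r.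
by rewrite -ind_class_tensM ?mulgKV.
Qed.

Definition wcoord (k : gT * 'I_d) (w : W) : F^o := w k.1 k.2 0.

Fact wcoord_linear k : linear (wcoord k).
Proof. by move=> r w w'; rewrite /wcoord !ffunE !mxE. Qed.
HB.instance Definition _ k :=
  GRing.isLinear.Build F W F^o _ (wcoord k) (wcoord_linear k).

Lemma wcoord_sum w :
  w = \sum_k wcoord k w *: tens k.1 (delta_mx k.2 0).
Proof.
rewrite -(pair_bigA _ (fun y i => wcoord (y, i) w *: tens y (delta_mx i 0))) /=.
rewrite {1}[w]tens_sum; apply: eq_bigr => y _.
rewrite {1}[w y]matrix_sum_delta linear_sum; apply: eq_bigr => i _.
by rewrite big_ord1 linearZ.
Qed.

(** The action of [a] on the quotient factors as the projection [ind_class]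
    after [act_free a \o avg], so the cyclicity of the trace applies. *)
Lemma dcharacter_ind_act a : dcharacter (ind_act rV) a =
  \sum_y \sum_i act_free u a (avg (tens y (delta_mx i 0))) y i 0.
Proof.
pose g : {linear W -> ind_mod rV} := ind_class rV.
pose h : {linear ind_mod rV -> W} := act_free u a \o avg \o vsval.
rewrite pair_bigA (dcharacter_factor (g := g) (h := h) wcoord_sum) => [|q].
  apply: eq_bigr => -[y i] _; rewrite /wcoord /h /g /=; set w := tens _ _.
  suff -> : avg (vsval (ind_class rV w)) = avg w by [].
  apply/eqP; rewrite -subr_eq0 -linearB; apply/eqP/avg_balance_rel.
  by rewrite -(ind_class_eq0 rV) linearB /= ind_class_onto subrr.
rewrite /g /h /= -ind_act_class ind_class_avg ?ind_class_onto //.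
Qed.

(** The element x moves the copy of the representation at the coset of y to the
    coset of x y. It contributes to the trace when the two cosets agree, and
    then the block on the diagonal is the action of y^-1 x y. *)
Lemma dcharacter_ind_dbasis h x :
  dcharacter (ind_act rV) (dbasis F (h, x)) = #|'C[u]%g|%:R^-1 *
    \sum_(y | (x * y * u * (x * y)^-1 == h)%g && (y^-1 * x * y \in 'C[u])%g)
      \tr (rV (y^-1 * x * y)%g).
Proof.
rewrite dcharacter_ind_act mulr_sumr [RHS]big_mkcond; apply: eq_bigr => y _ /=.
rewrite -[(_ == h)%g && _]andbC.
have actE i : act_free u (dbasis F (h, x)) (avg (tens y (delta_mx i 0))) y i 0 =
    if (y^-1 * x * y \in 'C[u])%g && (x * y * u * (x * y)^-1 == h)%g
    then #|'C[u]%g|%:R^-1 * rV (y^-1 * x * y)%g i i else 0.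
  rewrite avg_tens linearZ linear_sum !ffunE sum_ffunE mxE summxE /=.
  rewrite (eq_bigr (fun c => if (c == y^-1 * x * y)%g &&
    (x * y * u * (x * y)^-1 == h)%g then rV c i i else 0)) => [|c Cc].
    case: ifP => [/andP[Cc ->]|].
      rewrite (bigD1 (y^-1 * x * y)%g) //= eqxx big1 ?addr0 // => c.
      by case/andP=> _ /negPf->.
    move=> nC; rewrite big1 ?mulr0 // => c Cc; case: eqP => //= cE.
    by rewrite -cE Cc /= in nC; rewrite nC.
  rewrite act_free_tens /act_tens /=.
  have -> : (x * (y * c^-1) * u * (x * (y * c^-1))^-1 =
             x * y * u * (x * y)^-1)%g.
    rewrite !invMg invgK -!mulgA; congr (_ * (_ * _))%g.
    by rewrite !mulgA (cent1P (groupVr Cc)) mulgKV.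
  case: ifP => _; last by rewrite andbF ffunE mxE.
  rewrite andbT ffunE mulgA.
  have -> : (y == x * y * c^-1)%g = (c == y^-1 * x * y)%g.
    by rewrite -(inj_eq (mulIg c)) mulgKV -(inj_eq (mulgI y^-1%g)) mulKg !mulgA.
  case: ifP => _; last by rewrite mxE.
  by rewrite -colE mxE.
rewrite (eq_bigr _ (fun i _ => actE i)); case: ifP => _; last by rewrite big1.
by rewrite -mulr_sumr.
Qed.

(** In the sum over h, x and y that results from [dLambda_powE] and
    [dcharacter_ind_dbasis], h is determined by x and y. Replacing x by its
    conjugate g = y^-1 x y makes the terms independent of y, and the sum over y
    cancels the factor 1/|G| of the integral. *)
Lemma FS_indicator_ind m : (0 < m)%N -> #|gT|%:R != 0 :> F ->
  FS_indicator m (dcharacter (ind_act rV)) = #|'C[u]%g|%:R^-1 *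
    \sum_(g | (g ^+ m \in 'C[u])%g && ((u * g^-1) ^+ m * g ^+ m == 1)%g)
      \tr (rV (g ^+ m)%g).
Proof.
move=> m_gt0 nzG; rewrite /FS_indicator dLambda_powE //.
have chiP : linear (dcharacter (ind_act rV) : D -> F^o).
  move=> r a b; rewrite /dcharacter scaler_sumr -big_split.
  apply: eq_bigr => i _ /=.
  by have [/(_ _ r a b)-> _ _ _] := ind_act_dmodule rV; rewrite linearP.
pose chi := HB.pack_for {linear D -> F^o} (dcharacter (ind_act rV))
  (GRing.isLinear.Build F D F^o _ _ chiP).
rewrite -[LHS]/(chi _) linearZ linear_sum.
pose conj x y := (x ^+ m * y * u * (x ^+ m * y)^-1)%g.
have chiE x : chi (\sum_(h | ((h * x^-1) ^+ m * x ^+ m)%g == 1%g)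
    dbasis F (h, (x ^+ m)%g)) = #|'C[u]%g|%:R^-1 *
    \sum_(y | ((conj x y * x^-1) ^+ m * x ^+ m == 1)%g &&
      (y^-1 * x ^+ m * y \in 'C[u])%g) \tr (rV (y^-1 * x ^+ m * y)%g).
  rewrite linear_sum /= /chi /=.
  under eq_bigr do rewrite dcharacter_ind_dbasis.
  rewrite -mulr_sumr (exchange_big_dep predT) //= [in RHS]big_mkcond /=.
  congr (_ * _); apply: eq_bigr => y _.
  rewrite (eq_bigl (fun h => (h == conj x y) &&
    (((conj x y * x^-1) ^+ m * x ^+ m == 1)%g &&
      (y^-1 * x ^+ m * y \in 'C[u])%g))) /=; last first.
    move=> h; rewrite /= -/(conj x y) [conj x y == h]eq_sym andbCA.
    by apply: andb_id2l => /eqP->.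
  case: ifP => _; last by rewrite big1 // => h; rewrite andbF.
  by rewrite (big_pred1 (conj x y)) // => h; rewrite /= andbT.
rewrite (eq_bigr _ (fun x _ => chiE x)) -mulr_sumr.
rewrite (exchange_big_dep predT) //=.
set S := (X in _ = _ * X).
rewrite (eq_bigr (fun=> S)) => [|y _].
  rewrite sumr_const -[S *+ _]mulr_natl [LHS]mulrCA [X in _ * X]mulrA.
  by rewrite mulVf ?mul1r.
(* The bound variable is now g, with x = y g y^-1. *)
rewrite (reindex_inj (conjg_inj y^-1%g)) /=.
have conjE g : (g ^ y^-1 = y * g * y^-1)%g by rewrite conjgE invgK !mulgA.
have powE g : (y^-1 * (g ^ y^-1) ^+ m * y = g ^+ m)%g.
  by rewrite -conjXg conjE !mulgA mulVg mul1g mulgKV.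
apply: eq_big => [g|g _]; rewrite powE // andbC; apply: andb_id2l => Cg.
have -> : conj (g ^ y^-1)%g y = (u ^ y^-1)%g.
  rewrite /conj -conjXg !conjE mulgKV invMg.
  by rewrite -2!mulgA [(_ * (u * _))%g]mulgA (cent1P Cg) -!mulgA mulKVg.
by rewrite -conjVg -conjMg -!conjXg -conjMg conjg_eq1.
Qed.
End InducedCharacter.

(** At m = |G| all powers g^m are trivial, so only the degree is seen. *)
Lemma FS_indicator_card (F : fieldType) (gT : finGroupType) (u : gT) d
    (rV : mx_representation F 'C[u] d) :
  #|'C[u]%g|%:R != 0 :> F -> #|gT|%:R != 0 :> F ->
  FS_indicator #|gT| (dcharacter (ind_act rV)) =
    #|'C[u]%g|%:R^-1 * (#|gT|%:R * d%:R).
Proof.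
move=> nzC nzG; have expG (g : gT) : (g ^+ #|gT| = 1)%g.
  by rewrite -cardsT; apply: (expg_cardG (G := [set: gT]%G)); rewrite inE.
rewrite FS_indicator_ind //; last by rewrite -cardsT cardG_gt0.
rewrite (eq_bigr (fun=> d%:R)) => [|g _].
  rewrite (eq_bigl xpredT) => [|g]; last by rewrite !expG group1 mulg1 eqxx.
  by rewrite sumr_const mulr_natl.
by rewrite expG repr_mx1 mxtrace1.
Qed.

(** * Groups whose irreducible representations have equal degrees *)

(** Schur's lemma: an endomorphism has an eigenvalue a, and A - a, which is not
    invertible, must vanish. *)
Lemma closed_group_splitting_field (F : numClosedFieldType)
  (gT : finGroupType) (G : {group gT}) : group_splitting_field F G.
Proof.
move=> n rG irrG; apply: cent_mx_scalar_abs_irr => //.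
rewrite leqNgt; apply/(has_non_scalar_mxP (scalar_mx_cent _ _)) => -[A].
rewrite memmx_cent_envelop => /centgmxP cGA nscA.
have [n_gt0 _] := (mx_irrP rG).1 irrG.
have [a] := eigenvalue_closed A n_gt0.
rewrite /eigenvalue /eigenspace kermx_eq0 row_free_unit => /negP[].
apply: (mx_Schur irrG); last first.
  rewrite subr_eq0; apply: contraNneq nscA => ->; exact: scalar_mx_is_scalar.
by apply/centgmxP=> x Gx; rewrite mulmxBl mulmxBr scalar_mxC cGA.
Qed.

(** The common degree is 1, that of the trivial representation. Since the
    squares of the degrees sum up to |G|, there are as many irreducible
    representations, hence conjugacy classes, as elements. *)
Lemma irr_equal_degree_abelian (F : numClosedFieldType)
    (gT : finGroupType) (G : {group gT}) :
  (forall n1 n2 (rG1 : mx_representation F G n1)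
     (rG2 : mx_representation F G n2),
     mx_irreducible rG1 -> mx_irreducible rG2 -> n1 = n2) -> abelian G.
Proof.
move=> eq_deg.
have sG : irrType F G := DecSocleType (regular_repr F G).
have F'G : ([pchar F]^'.-group G)%g.
  by apply/pgroupP=> p _ _; rewrite inE /= pchar_num.
have splitG := @closed_group_splitting_field F gT G.
have deg1 (i : sG) : irr_degree i = 1%N.
  apply: etrans (degree_irr1 sG).
  exact: eq_deg (socle_irr i) (socle_irr (principal_comp sG)).
rewrite card_classes_abelian -(card_irr_pchar sG F'G splitG).
rewrite -(sum_irr_degree_pchar sG F'G splitG).
by rewrite (eq_bigr (fun=> 1%N)) ?sum1_card // => i _; rewrite deg1.
Qed.

(** * Common powers in the symmetric groups of degree 3 and 4 *)

(** One-line notation: unlike elements of the type of permutations, such lists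
    can be multiplied by evaluation. *)
Definition oneline n (s : 'S_n) : seq nat := [seq val (s i) | i <- enum 'I_n].

Definition oneline_mul (s t : seq nat) := [seq nth 0%N t k | k <- s].
Definition oneline_exp n s m := iter m (oneline_mul s) (iota 0 n).

(** The search runs over h = u g^-1 and g, so that u = h g needs no inverse. The
    exponents of S_3 and S_4 divide 12, hence exponents below 12 suffice. In
    the last alternative x and y witness that the centralizer of u is not
    abelian; the nested conditionals keep evaluation from looking for them
    unless h^m g^m = 1 and g^m <> 1. *)
Definition common_power_check n :=
  let P := permutations (iota 0 n) in
  all (fun h => all (fun g => (oneline_exp n g 12 == iota 0 n) && all (fun m =>
    if oneline_mul (oneline_exp n h m) (oneline_exp n g m) != iota 0 n then true
    else if oneline_exp n g m == iota 0 n then true else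
    let u := oneline_mul h g in
    has (fun x => (oneline_mul x u == oneline_mul u x) && has (fun y =>
      (oneline_mul y u == oneline_mul u y) &&
      (oneline_mul x y != oneline_mul y x)) P) P)
   (iota 0 12)) P) P.

Lemma nth_oneline n (s : 'S_n) (i : 'I_n) : nth 0%N (oneline s) i = s i.
Proof. by rewrite /oneline (nth_map i) ?size_enum_ord // nth_ord_enum. Qed.

Lemma onelineM n (s t : 'S_n) :
  oneline (s * t)%g = oneline_mul (oneline s) (oneline t).
Proof.
rewrite /oneline_mul {1 3}/oneline -map_comp; apply: eq_map => i.
by rewrite permM /comp nth_oneline.
Qed.

Lemma oneline1 n : oneline (1%g : 'S_n) = iota 0 n.
Proof. by rewrite -val_enum_ord; apply: eq_map => i; rewrite perm1. Qed.

Lemma onelineX n (s : 'S_n) m :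
  oneline (s ^+ m)%g = oneline_exp n (oneline s) m.
Proof.
elim: m => [|m IHm]; first by rewrite oneline1.
by rewrite expgS onelineM IHm.
Qed.

Lemma oneline_inj n : injective (@oneline n).
Proof.
move=> s t st; apply/permP=> i; apply: ord_inj.
by rewrite -!nth_oneline st.
Qed.

Lemma oneline_perm n (s : 'S_n) : oneline s \in permutations (iota 0 n).
Proof.
rewrite mem_permutations -val_enum_ord /oneline (map_comp val); apply: perm_map.
apply: uniq_perm; rewrite ?(map_inj_uniq (@perm_inj _ s)) ?enum_uniq //.
move=> j; rewrite mem_enum -[j](permKV s) (mem_map (@perm_inj _ s)).
by rewrite mem_enum.
Qed.

Lemma oneline_eq n (s t : 'S_n) : (oneline s == oneline t) = (s == t).
Proof. exact: inj_eq (@oneline_inj n) _ _. Qed.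

(** There are n! lists and n! permutations. *)
Lemma oneline_surj n c : c \in permutations (iota 0 n) ->
  exists s : 'S_n, c = oneline s.
Proof.
have Us : uniq (map (@oneline n) (enum 'S_n)).
  by rewrite (map_inj_uniq (@oneline_inj n)) enum_uniq.
have [||_ <-] := uniq_min_size Us (s2 := permutations (iota 0 n)).
- by move=> _ /mapP[s _ ->]; apply: oneline_perm.
- rewrite size_permutations ?iota_uniq // size_iota size_map -cardE.
  by rewrite card_Sn.
by case/mapP=> s _ ->; exists s.
Qed.

Lemma common_power_trivial n (u g : 'S_n) m :
  common_power_check n -> abelian 'C[u]%g ->
  ((u * g^-1) ^+ m * g ^+ m = 1)%g -> (g ^+ m = 1)%g.
Proof.
move=> /allP chk abC; set h := (u * g^-1)%g => hg1.
have Eu : (u = h * g)%g by rewrite mulgKV.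
have exp12 s : (s ^+ 12 = 1 :> 'S_n)%g.
  have /allP/(_ _ (oneline_perm s))/andP[+ _] := chk _ (oneline_perm s).
  by rewrite -onelineX -oneline1 oneline_eq => /eqP.
have expE s : (s ^+ m = s ^+ (m %% 12) :> 'S_n)%g by rewrite expg_mod.
have /allP/(_ _ (oneline_perm g))/andP[_] := chk _ (oneline_perm h).
move/allP/(_ (m %% 12)%N); rewrite mem_iota ltn_pmod // => /(_ isT).
set P := permutations _.
rewrite -!onelineX -onelineM -oneline1 !oneline_eq -!expE hg1 eqxx.
rewrite -onelineM -Eu.
case: eqP => [//|_ /hasP[x /oneline_surj[s ->{x}] /andP[su /hasP[y]]]].
case/oneline_surj=> t ->{y} /andP[]; move: su.
rewrite -!onelineM !oneline_eq => /eqP su /eqP tu /eqP[].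
apply: (centP (subsetP abC s _)); exact/cent1P.
Qed.

Lemma common_power_check3 : common_power_check 3. Proof. by vm_compute. Qed.
Lemma common_power_check4 : common_power_check 4. Proof. by vm_compute. Qed.

(** * I-equivalence of the induced characters *)

Theorem lemma3p3p5 (R : realType) (n : nat) (hn : n = 3%N \/ n = 4%N)
    (u : 'S_n) :
  (forall chi chi' : ddouble R[i] {perm 'I_n} -> R[i],
     irreducible_dcharacter chi -> induced_dcharacter u chi ->
     irreducible_dcharacter chi' -> induced_dcharacter u chi' ->
     I_equivalent chi chi')
  <-> abelian 'C[u]%g.
Proof.
have nzG : #|{perm 'I_n}|%:R != 0 :> R[i].
  by rewrite -cardsT pnatr_eq0 -lt0n cardG_gt0.
have nzC : #|'C[u]%g|%:R != 0 :> R[i] by rewrite pnatr_eq0 -lt0n cardG_gt0.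
split=> [Ieq | abC chi chi' _ [d [rV [irrV chiE]]] _
  [d' [rV' [irrV' chiE']]] m m_gt0].
  apply: (@irr_equal_degree_abelian R[i]) => d d' rV rV' irrV irrV'.
  have indV k (rW : mx_representation R[i] 'C[u] k) : mx_irreducible rW ->
    induced_dcharacter u (dcharacter (ind_act rW)) by exists k, rW.
  have := Ieq _ _ (induced_dcharacter_irreducible (indV _ _ irrV))
    (indV _ _ irrV) (induced_dcharacter_irreducible (indV _ _ irrV'))
    (indV _ _ irrV') #|{perm 'I_n}|.
  have G_gt0 : (0 < #|{perm 'I_n}|)%N by rewrite -cardsT cardG_gt0.
  by move=> /(_ G_gt0); rewrite !FS_indicator_card // =>
    /(mulfI (invr_neq0 nzC))/(mulfI nzG)/eqP; rewrite eqr_nat => /eqP.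
rewrite /FS_indicator chiE chiE' -!/(FS_indicator _ _).
rewrite !FS_indicator_ind //; congr (_ * _).
apply: eq_bigr => g /andP[_ /eqP gu].
have splitC := @closed_group_splitting_field R[i] _ 'C[u]%G.
have chk : common_power_check n.
  by case: hn => ->; [apply: common_power_check3 | apply: common_power_check4].
have -> := common_power_trivial chk abC gu.
rewrite !repr_mx1 !mxtrace1.
rewrite (mx_irr_abelian_linear splitC irrV) //.
by rewrite (mx_irr_abelian_linear splitC irrV').
Qed.
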